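(* For every prime power $q$ we have $A_q(9,6;4)\ge q^{10}+q^3+1$.
   Context: For a prime power $q$, $\mathbb{F}_q$ is the finite field with $q$ elements, and $\mathcal{G}_q(n,k)$ is the set of all $k$-dimensional subspaces of $\mathbb{F}_q^n$. The subspace distance of two subspaces $U,W\subseteq\mathbb{F}_q^n$ is $d_S(U,W)=\dim U+\dim W-2\dim(U\cap W)$. $A_q(n,d;k)$ denotes the maximum size of a set $\mathcal{C}\subseteq\mathcal{G}_q(n,k)$ such that $d_S(U,W)\ge d$ for all distinct $U,W\in\mathcal{C}$. *)

(* Defs.v *)
From HB Require Import structures.
From mathcomp Require Import all_boot all_order all_algebra all_field.

Set Implicit Arguments.
Unset Strict Implicit.
Unset Printing Implicit Defensive.

Local Open Scope nat_scope.

Definition prime_power (q : nat) : Prop :=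
  exists p m : nat, [/\ prime p, 0 < m & q = p ^ m].

(* {vspace vT} has no finType structure in [vector]; over a finite field it
   gets one by identifying a subspace with the finite set of its vectors. *)
Fact vspace_setK (F : finFieldType) (n : nat) :
  cancel (fun U : {vspace 'rV[F]_n} => [set u in U])
         (fun A : {set 'rV[F]_n} => <<enum A>>%VS).
Proof.
move=> U; apply/eqP; rewrite eqEsubv; apply/andP; split.
  by apply/span_subvP => u; rewrite mem_enum inE.
by apply/subvP => u uU; rewrite memv_span // mem_enum inE.
Qed.

HB.instance Definition _ (F : finFieldType) (n : nat) :=
  CanIsCountable (@vspace_setK F n).
HB.instance Definition _ (F : finFieldType) (n : nat) :
    isFinite {vspace 'rV[F]_n} := CanIsFinite (@vspace_setK F n).

Section SubspaceCodes.

Variables (F : finFieldType) (n : nat).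

Implicit Types U W : {vspace 'rV[F]_n}.

Definition grassmannian (k : nat) : {set {vspace 'rV[F]_n}} :=
  [set U | \dim U == k].

(* The subtraction on nat does not truncate, as \dim (U :&: W) is at most
   \dim U and at most \dim W. *)
Definition subspace_dist U W : nat :=
  \dim U + \dim W - 2 * \dim (U :&: W).

Definition subspace_code (d k : nat) (C : {set {vspace 'rV[F]_n}}) : bool :=
  (C \subset grassmannian k) &&
  [forall U in C, forall W in C, (U != W) ==> (d <= subspace_dist U W)].

End SubspaceCodes.

(* A_q(n, d; k) with q = #|F|: the value depends on F only through its order,
   since finite fields of equal order are isomorphic. *)
Definition max_code_size (F : finFieldType) (n d k : nat) : nat :=
  \max_(C : {set {vspace 'rV[F]_n}} | subspace_code d k C) #|C|.

(* Main.v *)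
Require Import Defs.
From HB Require Import structures.
From mathcomp Require Import all_boot all_order all_algebra all_field.
From mathcomp Require Import all_fingroup all_solvable.

(** The code consists of a lifted maximum-rank-distance code, of size q^10,
    and q^3 + 1 further subspaces. Write F^9 = F^4 + S with dim S = 5.

    Lifted part. The Gabidulin construction ([gabidulin_code]) gives q^10
    matrices of size 4 x 5 any two of which differ by a matrix of rank at
    least 3. The graph of A is the row space of [1 | A]; the graphs of A and B
    meet in a copy of the kernel of A - B ([rank_cap_graphs]), so in dimension
    at most 1. Each graph meets S trivially.

    Further part. Take subspaces of the form <v> + P with v in F^4 and P a
    3-dimensional subspace of S. A graph meets such a subspace in dimension at
    most 1, because projecting along S is injective on the graph and maps
    <v> + P onto the line <v> ([rank_cap_graph_block]). If v and v' span
    different lines, then <v> + P and <v'> + P' meet inside S, hence in the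
    intersection of P and P' ([rank_cap_blocks]). What remains is to find
    q^3 + 1 lines of F^4 ([points_of_graphs]) and q^3 + 1 subspaces P of S, of
    dimension 3, that meet pairwise in dimension 1
    ([planes_meeting_in_points]). The latter are the dual of a partial spread
    of lines in PG(4, q), and again q^3 of them are graphs over a Gabidulin
    code, now of 3 x 2 matrices whose differences have rank 2.

    Two 4-dimensional subspaces that meet in dimension at most 1 are at
    subspace distance at least 4 + 4 - 2 = 6. *)

Set Implicit Arguments.
Unset Strict Implicit.
Unset Printing Implicit Defensive.

Local Open Scope nat_scope.

Import GRing.Theory passmx.

(** * Finite extensions of a finite field *)

Section FiniteExtensions.

Local Open Scope ring_scope.

Variable F : finFieldType.

Lemma natf_card_eq0 (K : fieldExtType F) m :
  (0 < m)%N -> (#|F| ^ m)%:R = 0 :> K.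
Proof.
move=> m_gt0; have F0 : #|F|%:R = 0 :> F.
  by rewrite -cardsT -FinRing.zmodXgE expg_cardG ?inE.
by rewrite natrX -scaler_nat F0 scale0r expr0n gtn_eqF.
Qed.

Lemma exprD_card (K : fieldExtType F) i (x y : K) :
  (x + y) ^+ (#|F| ^ i) = x ^+ (#|F| ^ i) + y ^+ (#|F| ^ i).
Proof.
have [p p_pr pF] := finPcharP F.
rewrite exprDn_pchar // (eq_pnat _ (pchar_lalg _)) (eq_pnat _ (pcharf_eq pF)).
have /and3P[pgF _ _] := fin_ring_pchar_abelem pF.
by rewrite pnatX -cardsT [X in X || _]pgF.
Qed.

Lemma exprZ_card (K : fieldExtType F) i c (x : K) :
  (c *: x) ^+ (#|F| ^ i) = c *: x ^+ (#|F| ^ i).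
Proof.
rewrite exprZn; congr (_ *: _).
by elim: i => [|i IHi]; rewrite ?expr1 // expnSr exprM IHi expf_card.
Qed.

(** The extension is the splitting field L of p = X^Q - X, where Q = q^m. The
    roots of p are the fixed points of an automorphism, the m-th power of the
    Frobenius generator [a] of the Galois group, so they form a subfield, and
    therefore all of L. As p' = -1, there are exactly Q of them. *)
Lemma finField_ext_exists m :
  (0 < m)%N -> exists K : fieldExtType F, \dim {:K} = m.
Proof.
move=> m_gt0; set Q := (#|F| ^ m)%N.
have Q_gt1 : (1 < Q)%N by rewrite -(exp1n m) ltn_exp2r ?finNzRing_gt1.
pose p (R : nzRingType) : {poly R} := 'X^Q - 'X.
have size_p (R : nzRingType) : size (p R) = Q.+1.
  by rewrite size_polyDl size_polyXn // size_polyN size_polyX.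
have [|L [zs Dp defL]] := FinSplittingFieldFor (p := p F).
  by rewrite -size_poly_gt0 size_p.
have {Dp} Dp : p L %= \prod_(z <- zs) ('X - z%:P).
  by move: Dp; rewrite rmorphB /= map_polyXn map_polyX.
have Uzs : uniq zs.
  rewrite -separable_prod_XsubC -(eqp_separable Dp) unlock /p.
  rewrite derivB derivXn derivX -scaler_nat natf_card_eq0 //.
  rewrite scale0r sub0r.
  by rewrite -[- 1]scaleN1r coprimepZr ?coprimep1 // oppr_eq0 oner_eq0.
have [a _ Da] := finField_galois_generator (sub1v {:L}%AS).
have Dam i x : (a ^+ i)%g x = x ^+ (#|F| ^ i).
  elim: i x => [|i IHi] x; first by rewrite gal_id.
  rewrite expgSr galM ?memvf // Da ?memvf // IHi dimv1 expn1.
  by rewrite -exprM mulnC -expnS.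
have in_zs z : (z \in zs) = ((a ^+ m)%g z == z).
  by rewrite Dam -root_prod_XsubC -(eqp_root Dp) rootE !hornerE subr_eq0.
have zsL z : z \in zs.
  rewrite in_zs; apply/eqP/fixedSpaceP.
  suff /subvP: ({:L} <= fixedSpace (a ^+ m)%g)%VS by apply; rewrite memvf.
  rewrite -defL; apply/Fadjoin_seqP; split; first exact: sub1v.
  by move=> y; rewrite in_zs => /eqP/fixedSpaceP.
have e_basis : basis_of {:L} (vbasis {:L}) by apply: vbasisP.
exists L; apply/eqP; rewrite -(eqn_exp2l _ _ (finNzRing_gt1 F)) -/Q.
have <- : size zs = Q.
  by apply: succn_inj; rewrite -(size_prod_XsubC _ id) -(eqp_size Dp) size_p.
have /card_uniqP : uniq (map (rVof (vbasis {:L})) zs).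
  by rewrite map_inj_uniq //; apply: can_inj (rVofK e_basis).
rewrite size_map => <-; rewrite -[\dim _ in X in X == _]mul1n -card_mx.
apply/eqP/esym/eq_card => x; rewrite !inE -[x](vecofK e_basis).
by rewrite map_f.
Qed.

End FiniteExtensions.

(** * Gabidulin codes *)

Section Gabidulin.

Local Open Scope ring_scope.

Variable F : finFieldType.

(** A nonzero linearized polynomial a_0 X + a_1 X^q + ... + a_(k-1) X^(q^(k-1))
    has at most q^(k-1) roots, so a d-dimensional space of roots, here
    parametrized by [g], has d < k. *)
Lemma linearized_roots (K : fieldExtType F) k (a : 'I_k -> K)
    d (g : 'rV[F]_d -> K) :
    (exists i, a i != 0) -> injective g ->
    (forall y, \sum_(i < k) a i * g y ^+ (#|F| ^ i) = 0) ->
  (d < k)%N.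
Proof.
move=> [i0 ai0] g_inj rootg.
have q_gt1 := finNzRing_gt1 F.
pose P : {poly K} := \sum_(i < k) a i *: 'X^(#|F| ^ i).
have Pnz : P != 0.
  apply: contraNneq ai0 => /polyP/(_ (#|F| ^ i0)%N).
  rewrite coef0 coef_sum (bigD1 i0) //= coefZ coefXn eqxx mulr1.
  rewrite big1 ?addr0 => [-> // | i neq_i].
  by rewrite coefZ coefXn eqn_exp2l // eq_sym val_eqE (negPf neq_i) mulr0.
have k_gt0 : (0 < k)%N by apply: leq_ltn_trans (ltn_ord i0).
have sizeP : (size P <= (#|F| ^ k.-1).+1)%N.
  apply: leq_trans (size_sum _ _ _) _; apply/bigmax_leqP => i _.
  rewrite (leq_trans (size_scale_leq _ _)) // size_polyXn ltnS leq_exp2l //.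
  by rewrite -ltnS prednK.
have /max_poly_roots : uniq (map g (enum 'rV[F]_d)).
  by rewrite map_inj_uniq ?enum_uniq.
move/(_ _ Pnz); rewrite size_map -cardE card_mx mul1n.
move=> /(_ _)/leq_trans-/(_ _ _ sizeP).
rewrite ltnS leq_exp2l // -(ltnS d) prednK //; apply.
apply/allP => _ /mapP[y _ ->]; rewrite rootE horner_sum -[X in _ == X](rootg y).
by apply/eqP/eq_bigr => i _; rewrite !hornerE.
Qed.

(** Let K be the extension of F of degree m. The rows of A are read as
    coefficients a_0, ..., a_(k-1) in K, and [G A] is the matrix of the
    F-linear map x |-> a_0 x + a_1 x^q + ... + a_(k-1) x^(q^(k-1)), restricted
    to an n-dimensional subspace of K. By [linearized_roots] the kernel of
    [G A - G B] has dimension less than k. *)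
Lemma gabidulin_code k n m : (0 < m)%N -> (n <= m)%N ->
  exists G : 'M[F]_(k, m) -> 'M[F]_(n, m),
    forall A B, A != B -> (n < \rank (G A - G B)%R + k)%N.
Proof.
move=> /(finField_ext_exists F)[K dimK]; subst m => le_nm.
pose e := vbasis {:K}; have e_basis : basis_of {:K} e by apply: vbasisP.
pose iota (x : 'rV[F]_n) : K := vecof e (x *m pid_mx n).
have iota_inj : injective iota.
  apply: inj_comp; first exact: can_inj (vecofK e_basis).
  by apply: row_free_inj; rewrite -row_leq_rank rank_pid_mx.
pose G (A : 'M[F]_(k, \dim {:K})) := \matrix_(j < n)
  rVof e (\sum_(i < k) vecof e (row i A) * iota (delta_mx 0 j) ^+ (#|F| ^ i)).
exists G => A B neqAB.
(* Both [iota] and x |-> x^(q^i) are F-linear, so the basis vectors suffice. *)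
have mulG M (x : 'rV_n) :
    vecof e (x *m G M) = \sum_(i < k) vecof e (row i M) * iota x ^+ (#|F| ^ i).
  have iotaE : iota x = \sum_j x 0 j *: iota (delta_mx 0 j).
    rewrite {1}[x]row_sum_delta /iota mulmx_suml linear_sum.
    by apply: eq_bigr => j _; rewrite -scalemxAl linearZ.
  rewrite mulmx_sum_row linear_sum.
  under eq_bigr do rewrite linearZ rowK /= (rVofK e_basis) scaler_sumr.
  rewrite exchange_big; apply: eq_bigr => i _ /=.
  have expr0_card : 0 ^+ (#|F| ^ i) = 0 :> K.
    by rewrite expr0n expn_eq0 gtn_eqF // ltnW // finNzRing_gt1.
  rewrite iotaE (big_morph _ (exprD_card i) expr0_card) mulr_sumr.
  by apply: eq_bigr => j _; rewrite exprZ_card scalerAr.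
set Z := kermx (G A - G B); pose g y := iota (y *m row_base Z).
suff : (\rank Z < k)%N by rewrite mxrank_ker ltn_subLR ?rank_leq_row.
apply: (@linearized_roots _ k (fun i => vecof e (row i (A - B))) _ g).
- apply/existsP; apply: contraR neqAB => /existsPn eqAB.
  apply/eqP/row_matrixP => i.
  apply/eqP; rewrite -subr_eq0 -linearB -(vecof_eq0 e_basis).
  exact: negbNE (eqAB i).
- by apply: inj_comp => //; apply/row_free_inj/row_base_free.
move=> y; set x := y *m row_base Z.
under eq_bigr do rewrite linearB linearB mulrBl.
rewrite sumrB -!mulG -linearB -mulmxBr -[RHS](linear0 (vecof e)).
congr (vecof e _); apply/eqP; rewrite -sub_kermx.
by rewrite (submx_trans (submxMl _ _)) // eq_row_base.
Qed.

End Gabidulin.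

(** * Subspace codes from matrices *)

Section RowSpaces.

Local Open Scope ring_scope.

Variable F : finFieldType.

Definition rowvs m n (M : 'M[F]_(m, n)) : {vspace 'rV[F]_n} :=
  limg (linfun (mulmxr M)).

Lemma mem_rowvs m n (M : 'M[F]_(m, n)) u : (u \in rowvs M) = (u <= M)%MS.
Proof.
apply/memv_imgP/submxP => [[x _ ->] | [x ->]]; exists x; rewrite ?memvf //;
  by rewrite lfunE.
Qed.

Lemma dim_rowvs m n (M : 'M[F]_(m, n)) : \dim (rowvs M) = \rank M.
Proof.
have -> : rowvs M = rowvs (row_base M).
  by apply/vspaceP => u; rewrite !mem_rowvs eq_row_base.
rewrite limg_dim_eq; first by rewrite dimvf /dim /= mul1n.
apply/eqP; rewrite capfv; apply/lker0P => x y; rewrite !lfunE /=.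
exact/row_free_inj/row_base_free.
Qed.

Lemma dim_cap_rowvs m1 m2 n (A : 'M[F]_(m1, n)) (B : 'M[F]_(m2, n)) :
  \dim (rowvs A :&: rowvs B) = \rank (A :&: B)%MS.
Proof.
rewrite -dim_rowvs; congr (\dim _); apply/vspaceP => u.
by rewrite memv_cap !mem_rowvs sub_capmx.
Qed.

(** The family is injective, as a k-dimensional subspace meets itself in
    dimension k > t, so its image is a code with as many elements as there are
    indices. *)
Lemma max_code_size_ge_family (I : finType) n k t (M : I -> 'M[F]_(k, n)) :
    (t < k)%N -> (forall i, \rank (M i) = k) ->
    (forall i j, i != j -> (\rank (M i :&: M j)%MS <= t)%N) ->
  (#|I| <= max_code_size F n (2 * (k - t)) k)%N.
Proof.
move=> lt_tk rkM capM.
have inj_M : injective (fun i => rowvs (M i)).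
  move=> i j /= eqM; apply/eqP; apply: contraLR lt_tk => /capM.
  by rewrite -dim_cap_rowvs eqM capvv dim_rowvs rkM leqNgt.
rewrite -(card_codom inj_M) -cardsE; apply: leq_bigmax_cond.
apply/andP; split.
  by apply/subsetP => U; rewrite !inE => /codomP[i ->]; rewrite dim_rowvs rkM.
apply/forall_inP => U; rewrite inE => /codomP[i ->].
apply/forall_inP => W; rewrite inE => /codomP[j ->].
apply/implyP => neq_ij; rewrite /subspace_dist /= !dim_rowvs !rkM dim_cap_rowvs.
rewrite addnn -mul2n -mulnBr leq_mul2l leq_sub2l ?capM //.
by apply: contraNneq neq_ij => ->.
Qed.

End RowSpaces.

(** * Intersections of graphs and blocks *)

Section Intersections.

Local Open Scope ring_scope.

Variable F : finFieldType.

Lemma rank_graph m p (A : 'M[F]_(m, p)) : \rank (row_mx 1%:M A) = m.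
Proof.
apply/eqP/row_freeP; exists (col_mx 1%:M 0).
by rewrite mul_row_col mulmx1 mulmx0 addr0.
Qed.

(** The first m coordinates are injective on the row space of [1 | A], which
    complements the span of the other p coordinates. *)
Lemma rank_cap_graph m p r (A : 'M[F]_(m, p)) (B : 'M[F]_(r, m + p)) :
  (\rank (row_mx 1%:M A :&: B)%MS <= \rank (lsubmx B))%N.
Proof.
set D := (_ :&: B)%MS.
have /submxP[Z DZ] : (D <= row_mx 1%:M A)%MS by apply: capmxSl.
have /submxP[Y DY] : (D <= B)%MS by apply: capmxSr.
have {1}-> : D = lsubmx D *m row_mx 1%:M A.
  by rewrite {1 2}DZ mul_mx_row mulmx1 row_mxKl mul_mx_row mulmx1.
apply: leq_trans (mxrankM_maxl _ _) _; apply: mxrankS.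
by rewrite DY -mulmx_lsub submxMl.
Qed.

(** Equality (x, xA) = (y, yB) forces x = y and x(A - B) = 0. *)
Lemma rank_cap_graphs m p (A B : 'M[F]_(m, p)) :
  (\rank (row_mx 1%:M A :&: row_mx 1%:M B)%MS + \rank (A - B)%R <= m)%N.
Proof.
set D := (_ :&: _)%MS.
have /submxP[Y DY] : (D <= row_mx 1%:M A)%MS by apply: capmxSl.
have /submxP[Z DZ] : (D <= row_mx 1%:M B)%MS by apply: capmxSr.
move: (DZ); rewrite {1}DY !mul_mx_row !mulmx1 => /eq_row_mx[eqYZ eqAB].
rewrite addnC -leq_subRL ?rank_leq_row // -mxrank_ker {1}DY.
apply: leq_trans (mxrankM_maxl _ _) (mxrankS _).
by rewrite sub_kermx mulmxBr eqAB eqYZ subrr.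
Qed.

Lemma rank_cap_graph_block m p r1 r2 (A : 'M[F]_(m, p))
    (v : 'M[F]_(r1, m)) (P : 'M[F]_(r2, p)) :
  (\rank (row_mx 1%:M A :&: block_mx v 0 0 P)%MS <= \rank v)%N.
Proof.
apply: leq_trans (rank_cap_graph _ _) _.
by rewrite block_mxEh row_mxKl rank_col_mx0.
Qed.

(** As the row spaces of v1 and v2 meet trivially, the intersection has zero
    left part, and so lies in both P1 and P2. *)
Lemma rank_cap_blocks m1 m2 r1 r2 n p
    (v1 : 'M[F]_(m1, n)) (v2 : 'M[F]_(m2, n))
    (P1 : 'M[F]_(r1, p)) (P2 : 'M[F]_(r2, p)) : (v1 :&: v2)%MS = 0 ->
  (\rank (block_mx v1 0 0 P1 :&: block_mx v2 0 0 P2)%MS <=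
     \rank (P1 :&: P2)%MS)%N.
Proof.
move=> v12; set D := (_ :&: _)%MS.
have sub_block r m (v : 'M_(r, n)) (P : 'M_(m, p)) :
    (D <= block_mx v 0 0 P)%MS -> (lsubmx D <= v)%MS /\ (rsubmx D <= P)%MS.
  case/submxP=> Y ->; rewrite -[Y]hsubmxK mul_row_block !mulmx0 addr0 add0r.
  by rewrite row_mxKl row_mxKr !submxMl.
have [sDl1 sDr1] := sub_block _ _ _ _ (capmxSl _ _).
have [sDl2 sDr2] := sub_block _ _ _ _ (capmxSr _ _).
have D0 : lsubmx D = 0 by apply/eqP; rewrite -submx0 -v12 sub_capmx sDl1.
have {1}-> : D = rsubmx D *m row_mx 0 1%:M.
  by rewrite -{1}[D]hsubmxK D0 mul_mx_row mulmx0 mulmx1.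
apply: leq_trans (mxrankM_maxl _ _) (mxrankS _).
by rewrite sub_capmx sDr1.
Qed.

End Intersections.

(** * The additional codewords *)

Section AdditionalCodewords.

Local Open Scope ring_scope.

Variable F : finFieldType.

(** The affine points (1, w) together with one point (0, e) at infinity. The
    affine points are graphs of 1 x (n + 1) matrices, so the bounds on
    intersections of graphs show that the lines are distinct. *)
Lemma points_of_graphs n :
  exists v : option 'rV[F]_n.+1 -> 'rV[F]_(1 + n.+1),
    (forall w, v w != 0) /\
    (forall w w', w != w' -> (v w :&: v w')%MS = 0).
Proof.
pose e : 'rV[F]_n.+1 := delta_mx 0 0.
have nz_e : e != 0 by rewrite -mxrank_eq0 mxrank_delta.
pose v w : 'rV[F]_(1 + n.+1) :=
  if w is Some w then row_mx 1%:M w else row_mx 0 e.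
have v_graph w : (v (Some w) :&: v None)%MS = 0.
  apply/eqP; rewrite -mxrank_eq0 -leqn0.
  by apply: leq_trans (rank_cap_graph _ _) _; rewrite row_mxKl mxrank0.
exists v; split=> [[w|] | [w|] [w'|] neqw] //.
- by rewrite row_mx_eq0 oner_eq0.
- by rewrite row_mx_eq0 negb_and nz_e orbT.
- apply/eqP; rewrite -mxrank_eq0.
  have := rank_cap_graphs w w'; rewrite rank_rV subr_eq0.
  by rewrite (contraNneq _ neqw) => [|->] //; rewrite addn1 ltnS leqn0.
by rewrite capmxC v_graph.
Qed.

(** The graphs of 3 x 2 matrices with differences of rank 2, as many as
    vectors w, and the space <e> + F^2, which meets every graph in dimension
    at most 1. The matrices are transposed because [gabidulin_code] needs at
    least as many columns as rows. *)
Lemma planes_meeting_in_points :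
  exists P : option 'rV[F]_3 -> 'M[F]_(3, 5),
    (forall w, \rank (P w) = 3) /\
    (forall w w', w != w' -> (\rank (P w :&: P w')%MS <= 1)%N).
Proof.
have [||H rkH] := @gabidulin_code F 1 2 3; [by []|by []|].
pose e : 'rV[F]_3 := delta_mx 0 0.
pose P w : 'M[F]_(1 + 2, 3 + 2) :=
  if w is Some w then row_mx 1%:M (H w)^T else block_mx e 0 0 1%:M.
have rank_e : \rank e = 1%N by rewrite mxrank_delta.
have P_graph w : (\rank (P (Some w) :&: P None)%MS <= 1)%N.
  by have := rank_cap_graph_block (H w)^T e (1%:M : 'M_2); rewrite rank_e.
exists P; split=> [[w|] | [w|] [w'|] neqw] //.
- exact: rank_graph.
- by have := rank_diag_block_mx e (1%:M : 'M_2); rewrite rank_e mxrank1.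
- have := rank_cap_graphs (H w)^T (H w')^T.
  rewrite -linearB mxrank_tr; have := rkH w w' neqw.
  rewrite addn1 ltnS => le2 le3; rewrite -(leq_add2r 2).
  by apply: leq_trans le3; rewrite leq_add2l.
by rewrite capmxC P_graph.
Qed.

End AdditionalCodewords.

Theorem theorem10 (q : nat) (hq : prime_power q)
    (F : finFieldType) (hF : #|F| = q) :
  q ^ 10 + q ^ 3 + 1 <= max_code_size F 9 6 4.
Proof.
have [||G rkG] := @gabidulin_code F 2 4 5; [by []|by []|].
have [v [nz_v indep_v]] := points_of_graphs F 2.
have [P [rkP capP]] := planes_meeting_in_points F.
pose M (i : 'M[F]_(2, 5) + option 'rV[F]_3) : 'M[F]_(4, 4 + 5) :=
  match i with
  | inl A => row_mx 1%:M%R (G A)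
  | inr w => block_mx (v w) 0%R 0%R (P w) : 'M_(1 + 3, 4 + 5)
  end.
have card_I : #|{: 'M[F]_(2, 5) + option 'rV[F]_3}| = (q ^ 10 + q ^ 3 + 1)%N.
  by rewrite card_sum card_option !card_mx hF -addnA addn1.
rewrite -card_I; apply: (@max_code_size_ge_family F _ 9 4 1 M) => //.
  case=> [A | w]; first exact: rank_graph.
  by have := rank_diag_block_mx (v w) (P w); rewrite rkP rank_rV nz_v.
have cap_graph_block A w : (\rank (M (inl A) :&: M (inr w))%MS <= 1)%N.
  by have := rank_cap_graph_block (G A) (v w) (P w); rewrite rank_rV nz_v.
move=> [A|w] [A'|w'] neq_ij.
- have := rkG A A' neq_ij; have := rank_cap_graphs (G A) (G A').
  rewrite addn2 !ltnS => le4 le2; rewrite -(leq_add2r 3).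
  by apply: leq_trans le4; rewrite leq_add2l.
- exact: cap_graph_block.
- by rewrite capmxC; apply: cap_graph_block.
have := rank_cap_blocks (P w) (P w') (indep_v _ _ neq_ij).
by move/leq_trans; apply; apply: capP.
Qed.
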